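(* Consider the functional equation $$f(a)=g(a)+x\,f\!\left(\frac{a}{p}\right).$$ If $|x|<1$, $f(0)$ is finite, $p$ is real with $p>1$, and the series below converges, then $$f(a)=\sum_{j=0}^{\infty}x^{j}\,g\!\left(\frac{a}{p^{j}}\right).$$
   Context: Here $f$ and $g$ are functions of the variable $a$, related by the functional equation; $a$, $x$ and $p$ are real, and $j$ is the integer summation index.
   Formalization: ''f(0) is finite'' is taken to mean that f is bounded near 0; a finite value at 0 alone does not suffice (g=0, x=1/p, f(a)=1/a for a≠0, f(0)=0 satisfies the equation but not the series formula). *)

(* Defs.v *)
From mathcomp Require Import all_boot all_order all_algebra.
From mathcomp Require Import all_classical all_reals all_analysis.
Export numFieldNormedType.Exports.

Set Implicit Arguments.
Unset Strict Implicit.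
Unset Printing Implicit Defensive.

Import Order.TTheory GRing.Theory Num.Theory.
Local Open Scope classical_set_scope.
Local Open Scope ring_scope.

(* "f(0) is finite": f does not blow up at the point a.  Since f is total and
   real-valued, requiring a real value f a would be vacuous: f t = t^-1 (with
   f 0 = 0), g = 0, x = p^-1 satisfies the functional equation everywhere, but
   not the series formula.  Continuity at a, or a finite limit at a, implies
   this condition. *)
Definition finite_at (R : realType) (f : R -> R) (a : R) : Prop :=
  bounded_near f (nbhs a).

(* Main.v *)
(* Iterating the equation n times gives the nth partial sum plus the remainder
   x^n f(a/p^n).  As a/p^n tends to 0 and f is bounded near 0, the remainder is
   eventually at most M|x|^n in absolute value, hence tends to 0. *)

Require Import Defs.
From mathcomp Require Import all_boot all_order all_algebra.
From mathcomp Require Import all_classical all_reals all_analysis.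
Import Order.TTheory GRing.Theory Num.Theory.
Local Open Scope classical_set_scope.
Local Open Scope ring_scope.

Lemma functional_eq_iter (F : fieldType) (f g : F -> F) (x p : F)
    (hfg : forall a, f a = g a + x * f (a / p)) (a : F) (n : nat) :
  f a = \sum_(0 <= j < n) x ^+ j * g (a / p ^+ j) + x ^+ n * f (a / p ^+ n).
Proof.
elim: n => [|n IHn]; first by rewrite big_geq // add0r !expr0 mul1r divr1.
rewrite big_nat_recr //= -addrA {1}IHn; congr (_ + _).
(* The equation at [a / p ^+ n] splits the old remainder into the next term and the next
   remainder. *)
by rewrite hfg mulrDr mulrA -exprSr -mulrA -invfM -exprSr.
Qed.

Lemma cvg_div_expr (R : realType) (a p : R) :
  1 < p -> a / p ^+ n @[n --> \oo] --> 0.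
Proof.
move=> hp; have p0 : 0 < p by apply: lt_trans hp.
rewrite -(mulr0 a); apply: cvgMr.
(* The factor becomes a geometric sequence of ratio [p^-1], between 0 and 1. *)
under eq_fun do rewrite -exprVn.
by apply: cvg_expr; rewrite gtr0_norm ?invr_gt0// invf_lt1.
Qed.

Lemma cvg_expr_mul_bounded (R : realType) (f : R -> R) (x : R) (u : R ^nat) :
    `|x| < 1 -> bounded_near f (nbhs 0) -> u n @[n --> \oo] --> 0 ->
  x ^+ n * f (u n) @[n --> \oo] --> 0.
Proof.
move=> hx /ex_bound[M hM] hu; apply/norm_cvg0P.
have hMx : `|x| ^+ n * M @[n --> \oo] --> 0.
  by rewrite -(mul0r M); apply: cvgMl; apply: cvg_expr; rewrite normr_id.
apply: (squeeze_cvgr _ (cvg_cst 0) hMx).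
near=> n; rewrite normr_ge0 normrM normrX ler_wpM2l ?exprn_ge0//.
(* The bound [M] holds on a neighbourhood of 0; [hu] pulls it back to all large [n]. *)
by near: n; exact: hu hM.
Unshelve. all: by end_near. Qed.

Theorem lemmaA1 (R : realType) (f g : R -> R) (x p : R)
    (hfg : forall a : R, f a = g a + x * f (a / p))
    (hx : `|x| < 1)
    (hf0 : finite_at f 0)
    (hp : 1 < p)
    (a : R)
    (hcvg : cvgn (series (fun j : nat => x ^+ j * g (a / p ^+ j)))) :
  f a = limn (series (fun j : nat => x ^+ j * g (a / p ^+ j))).
Proof.
have hr := cvg_expr_mul_bounded _ _ _ _ hx hf0 (cvg_div_expr _ a _ hp).
(* Limits are unique, so convergence to [f a] suffices; writing it as [f a - 0] matches partial sum
   = [f a] minus remainder. *)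
apply/esym/cvg_lim => //; rewrite -[X in _ --> X]subr0.
have -> : series (fun j : nat => x ^+ j * g (a / p ^+ j)) =
    (fun n => f a - x ^+ n * f (a / p ^+ n)).
  by apply/funext => n; rewrite /series/= (functional_eq_iter _ _ _ _ _ hfg a n) addrK.
by apply: cvgB hr; exact: cvg_cst.
Qed.
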